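(* Let $d\ge 0$ be an integer, let $G$ be a partial cube of VC-dimension $\le d$, isometrically embedded in $Q_m$, and let $G'$ be obtained from $G$ by an isometric expansion with respect to an isometric cover $(G^1,G^0,G^2)$ of $G$. Then $G'$ is a partial cube of VC-dimension $\le d$ if and only if $G^0$ has VC-dimension $\le d-1$.
   Context: All graphs are finite and simple, and connected (except possibly $G^0$). $Q_m$ has as vertices the subsets of $\{1,\dots,m\}$, adjacent iff their symmetric difference has size $1$. An induced subgraph $H$ of $G$ is isometric if distances in $H$ equal those in $G$. A partial cube is a graph isometrically embeddable in a hypercube; it is identified with its image, an induced subgraph of $Q_m$, hence with a set family. The VC-dimension of a nonempty set family $\mathcal S$ (or of an induced subgraph of a hypercube) is the maximum size of a set $X$ with $\{X\cap S:S\in\mathcal S\}=2^X$. A triplet $(G^1,G^0,G^2)$ is an isometric cover of a connected graph $G$ if $G^1$ and $G^2$ are isometric subgraphs of $G$, $V(G)=V(G^1)\cup V(G^2)$, $E(G)=E(G^1)\cup E(G^2)$, $V(G^1)\cap V(G^2)\neq\varnothing$, and $G^0$ is the subgraph of $G$ induced by $V(G^1)\cap V(G^2)$. The isometric expansion of $G$ with respect to $(G^1,G^0,G^2)$ is the graph obtained by taking disjoint copies of $G^1$ and $G^2$ and adding an edge between the two copies of each vertex of $G^0$. *)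

(* Defs.v *)
From mathcomp Require Import all_boot.

Set Implicit Arguments.
Unset Strict Implicit.
Unset Printing Implicit Defensive.

Record sgraph := SGraph {
  svertex :> finType;
  sedge : rel svertex;
  sedge_sym : symmetric sedge;
  sedge_irr : irreflexive sedge }.

Arguments sedge {s}.

Definition connected (G : sgraph) : Prop := forall x y : G, connect sedge x y.

Definition walk (G : sgraph) (x y : G) (n : nat) : bool :=
  [exists p : n.-tuple G, path sedge x p && (last x p == y)].

(* A shortest path visits no vertex twice, so it has fewer than #|G| edges;   *)
(* None stands for the infinite distance between different components.        *)
Definition dist (G : sgraph) (x y : G) : option nat :=
  ohead [seq n <- iota 0 #|G| | walk x y n].

Section Induced.
Variables (G : sgraph) (V : {set G}).

Definition induced_edge : rel {x : G | x \in V} :=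
  fun x y => sedge (val x) (val y).

Lemma induced_edge_sym : symmetric induced_edge.
Proof. by move=> x y; apply: sedge_sym. Qed.

Lemma induced_edge_irr : irreflexive induced_edge.
Proof. by move=> x; apply: sedge_irr. Qed.

Definition induced : sgraph := SGraph induced_edge_sym induced_edge_irr.

Definition isometric_subgraph : Prop :=
  forall x y : induced, dist x y = dist (val x) (val y).
End Induced.

Section Hypercube.
Variable m : nat.

Definition symdiff (A B : {set 'I_m}) : {set 'I_m} := (A :\: B) :|: (B :\: A).

Definition cube_edge : rel {set 'I_m} := fun A B => #|symdiff A B| == 1.

Lemma cube_edge_sym : symmetric cube_edge.
Proof. by move=> A B; rewrite /cube_edge /symdiff setUC. Qed.

Lemma cube_edge_irr : irreflexive cube_edge.
Proof. by move=> A; rewrite /cube_edge /symdiff setDv setU0 cards0. Qed.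

Definition hypercube : sgraph := SGraph cube_edge_sym cube_edge_irr.
End Hypercube.

Definition isometric_embedding (G H : sgraph) (f : G -> H) : Prop :=
  forall x y : G, dist (f x) (f y) = dist x y.

Section VCdim.
Variable T : finType.
Implicit Types (F : {set {set T}}) (X : {set T}).

Definition shatters F X : bool := [set X :&: A | A in F] == powerset X.

(* Meaningful for F nonempty only: the empty family shatters nothing, not     *)
(* even set0, and gets the value 0.                                           *)
Definition vcdim F : nat := \max_(X : {set T} | shatters F X) #|X|.
End VCdim.

Definition family_of (G : sgraph) (m : nat) (f : G -> hypercube m) (V : {set G})
  : {set {set 'I_m}} := [set (f x : {set 'I_m}) | x in V].

(* Isometric embeddings of G in hypercubes agree up to cube automorphisms and *)
(* constant coordinates, so the choice of the embedding f is immaterial.      *)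
Definition partial_cube_vcdim_le (G : sgraph) (d : nat) : Prop :=
  exists (m : nat) (f : G -> hypercube m),
    isometric_embedding f /\ vcdim (family_of f [set: G]) <= d.

(* Isometric subgraphs are induced, so a cover is given by the vertex sets    *)
(* V1 and V2 of its two sides; G^0 is then induced by V1 :&: V2.              *)
Record isometric_cover (G : sgraph) (V1 V2 : {set G}) : Prop := IsometricCover {
  cover_isometric1 : isometric_subgraph V1;
  cover_isometric2 : isometric_subgraph V2;
  cover_vertices : [set: G] = V1 :|: V2;
  cover_edges : forall x y : G,
    sedge x y = [&& x \in V1, y \in V1 & sedge x y]
             || [&& x \in V2, y \in V2 & sedge x y];
  cover_meet : V1 :&: V2 != set0 }.

Section Expansion.
Variables (G : sgraph) (V1 V2 : {set G}).

(* val x == val y forces this vertex to lie in V1 :&: V2.                     *)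
Definition expansion_edge : rel (induced V1 + induced V2)%type :=
  fun u v => match u, v with
    | inl x, inl y => sedge x y
    | inr x, inr y => sedge x y
    | inl x, inr y => val x == val y
    | inr x, inl y => val x == val y
    end.

Lemma expansion_edge_sym : symmetric expansion_edge.
Proof.
by move=> [x|x] [y|y]; first [exact: (@sedge_sym (induced _)) | exact: eq_sym].
Qed.

Lemma expansion_edge_irr : irreflexive expansion_edge.
Proof. by move=> [x|x]; apply: sedge_irr. Qed.

Definition expansion : sgraph := SGraph expansion_edge_sym expansion_edge_irr.
End Expansion.

(* Main.v *)
Require Import Defs.
From mathcomp Require Import all_boot all_order all_algebra.

(** Appending to a vertex of the expansion the side on which it lies gives an
    isometric embedding of the expansion in one more dimension.  Indeed a
    geodesic from V1 to V2 crosses V1 :&: V2, because no edge of G joins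
    V1 :\: V2 to V2 :\: V1.  The same crossing argument shows that a set
    containing the new coordinate is shattered by the expansion if and only if
    the rest of it is shattered by V1 :&: V2: the crossing point agrees with both
    ends of the geodesic wherever they agree with each other.  Finally the
    VC-dimension does not depend on the embedding: a non-constant coordinate
    changes along some edge uv, and the halfspaces it cuts out are described
    by comparing the distances to u and to v. *)

Set Implicit Arguments.
Unset Strict Implicit.
Unset Printing Implicit Defensive.

(** * Walks and graph distance *)

Section Walks.
Implicit Types G H : sgraph.

Lemma walkP G (x y : G) n :
  reflect (exists p : seq G, [/\ size p = n, path sedge x p & last x p = y])
          (walk x y n).
Proof.
apply: (iffP existsP) => [[p /andP[pp /eqP lp]]|[p [sp pp lp]]].
  by exists p; rewrite size_tuple.
have sp' : size p == n by rewrite sp.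
by exists (Tuple sp'); rewrite /= pp lp eqxx.
Qed.

Lemma walk0 G (x y : G) : walk x y 0 = (x == y).
Proof.
apply/walkP/eqP => [[p [/size0nil-> _ //]]|->].
by exists [::].
Qed.

Lemma walkS G (x y : G) n :
  reflect (exists2 z, sedge x z & walk z y n) (walk x y n.+1).
Proof.
apply: (iffP (walkP x y n.+1)) => [[[|z p] [//= [sp] /andP[xz pp] lp]]|].
  by exists z => //; apply/walkP; exists p.
case=> z xz /walkP[p [sp pp lp]]; exists (z :: p).
by split; rewrite //= ?sp ?xz.
Qed.

Lemma walk_cat G (x y z : G) k l :
  walk x y k -> walk y z l -> walk x z (k + l).
Proof.
move=> /walkP[p [sp pp lp]] /walkP[q [sq pq lq]]; apply/walkP.
exists (p ++ q); split; first by rewrite size_cat sp sq.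
  by rewrite cat_path pp lp.
by rewrite last_cat lp.
Qed.

Lemma walk_map G H (f : G -> H) (x y : G) n :
  (forall u v : G, sedge u v -> sedge (f u) (f v)) ->
  walk x y n -> walk (f x) (f y) n.
Proof.
move=> fE; elim: n x => [|n IHn] x; first by rewrite !walk0 => /eqP->.
by move=> /walkS[z xz /IHn wz]; apply/walkS; exists (f z) => //; exact: fE.
Qed.

Lemma walk_sym G (x y : G) n : walk x y n -> walk y x n.
Proof.
elim: n x => [|n IHn] x; first by rewrite !walk0 eq_sym.
move=> /walkS[z xz /IHn wz]; rewrite -addn1; apply: walk_cat wz _.
by apply/walkS; exists x; rewrite ?walk0 // sedge_sym.
Qed.

(** [dist] only searches lengths below [#|G|]; shortening a walk to a duplicate-free path shows that
    the minimum is never missed. *)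
Lemma distP G (x y : G) n :
  dist x y = Some n <-> walk x y n /\ forall k, walk x y k -> n <= k.
Proof.
have short k : walk x y k -> exists2 l, l <= k & (l < #|G|) && walk x y l.
  move=> /walkP[p [<- pp lp]]; move: lp; case/shortenP: pp => q pq uq sub lq.
  exists (size q); first by case/andP: (uq) => _ /uniq_leq_size; apply.
  have := max_card (mem (x :: q)); rewrite (card_uniqP uq) => /= -> /=.
  by apply/walkP; exists q.
rewrite /dist; split.
  case def_s: [seq _ <- _ | _] => [//|l s] [<-{n}].
  have := mem_head l s; rewrite -def_s mem_filter => /andP[wl _].
  split=> // k /short[j jk /andP[jG wj]]; apply: leq_trans jk.
  have: j \in l :: s by rewrite -def_s mem_filter wj mem_iota.
  (* The filtered list is increasing, so its head is its least element. *)
  have: sorted ltn (l :: s).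
    by rewrite -def_s sorted_filter ?iota_ltn_sorted //; exact: ltn_trans.
  rewrite /= inE => /(order_path_min ltn_trans)/allP lt_s /predU1P[-> //|].
  by move=> /lt_s/ltnW.
move=> [wn minn]; have [l ln /andP[lG wl]] := short _ wn.
have nG : n < #|G| by apply: leq_ltn_trans (minn _ wl) lG.
(* The range is cut just before [n]: the filter is empty on the first piece, and [n] heads the
   second. *)
rewrite -(subnKC nG) addSnnS iotaD filter_cat add0n /= wn.
rewrite (eq_in_filter (a2 := pred0)) ?filter_pred0 // => k.
by rewrite mem_iota /= add0n => kn; apply: contraTF kn => /minn; rewrite -leqNgt.
Qed.

End Walks.

Lemma connect_change (T : finType) (e : rel T) (P : pred T) x y :
  connect e x y -> P x -> ~~ P y -> exists u v, [/\ e u v, P u & ~~ P v].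
Proof.
move=> /connectP[p pp ->{y}]; elim: p x pp => [|z p IHp] x /=.
  by move=> _ ->.
move=> /andP[xz pp] Px; have [Pz|nPz] := boolP (P z); first exact: IHp.
by exists x, z.
Qed.

(** * Hamming distance in the hypercube *)

Section Hamming.
Variable m : nat.
Implicit Types A B C : {set 'I_m}.

Lemma in_symdiff A B i : (i \in symdiff A B) = (i \in A) (+) (i \in B).
Proof. by rewrite !inE; case: (i \in A) (i \in B) => [] []. Qed.

Lemma symdiffC A B : symdiff A B = symdiff B A.
Proof. by rewrite /symdiff setUC. Qed.

Lemma card_symdiff0 A B : (#|symdiff A B| == 0) = (A == B).
Proof.
apply/eqP/eqP => [/cards0_eq e|->]; last by rewrite /symdiff setDv setU0 cards0.
apply/setP => i; move/setP/(_ i): e; rewrite in_symdiff inE.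
by case: (i \in A) (i \in B) => [] [].
Qed.

Lemma card_symdiff_trans A B C :
  #|symdiff A C| <= #|symdiff A B| + #|symdiff B C|.
Proof.
apply: leq_trans (leq_card_setU _ _); apply/subset_leq_card/subsetP => i.
by rewrite in_setU !in_symdiff; case: (_ \in A) (_ \in B) (_ \in C) => [] [] [].
Qed.

(** If [B] disagreed at [i] with the common value of [A] and [C], then [i] would be counted in both
    summands, making the triangle inequality strict. *)
Lemma card_symdiff_between A B C i :
  #|symdiff A B| + #|symdiff B C| = #|symdiff A C| ->
  (i \in A) = (i \in C) -> (i \in B) = (i \in A).
Proof.
move=> geo iAC; apply/eqP; apply: contra_eqT geo => iB.
rewrite gtn_eqF // -cardsUI.
have sub : symdiff A C \subset symdiff A B :|: symdiff B C.
  apply/subsetP => j; rewrite in_setU !in_symdiff.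
  by case: (_ \in A) (_ \in B) (_ \in C) => [] [] [].
apply: leq_ltn_trans (subset_leq_card sub) _.
rewrite -addn1 leq_add2l card_gt0; apply/set0Pn; exists i.
by rewrite inE !in_symdiff -iAC; case: (_ \in A) (_ \in B) iB => [] [].
Qed.

(** The distances from [C] to [A] and to [B] have the same contribution off [i], so coordinate [i]
    alone decides which is smaller. *)
Lemma card_symdiff_halfspace A B C i :
  symdiff A B = [set i] ->
  (#|symdiff C B| < #|symdiff C A|) = (i \in C) (+) (i \in A).
Proof.
move=> eAB.
have e j : (j \in A) (+) (j \in B) = (j == i) by rewrite -in_symdiff eAB inE.
rewrite (cardsD1 i) [ltnRHS](cardsD1 i) !in_symdiff.
have -> : symdiff C B :\ i = symdiff C A :\ i.
  apply/setP => j; rewrite !in_setD1 !in_symdiff; have := e j.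
  by case: (j == i) (_ \in A) (_ \in B) => [] [] [].
rewrite ltn_add2r; have := e i; rewrite eqxx.
by case: (_ \in A) (_ \in B) (_ \in C) => [] [] [].
Qed.

Lemma walk_hypercube_min (x y : hypercube m) n :
  walk x y n -> #|symdiff x y| <= n.
Proof.
elim: n x => [|n IHn] x; first by rewrite walk0 leqn0 card_symdiff0.
move=> /walkS[z /eqP xz /IHn zy].
by apply: leq_trans (card_symdiff_trans x z y) _; rewrite xz add1n ltnS.
Qed.

Lemma walk_hypercube (x y : hypercube m) : walk x y #|symdiff x y|.
Proof.
move def_n: #|symdiff x y| => n; elim: n x def_n => [|n IHn] x xy.
  by rewrite walk0 -card_symdiff0 xy.
apply/walkS.
have /card_gt0P[i ixy] : 0 < #|symdiff x y| by rewrite xy.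
(* Flipping a coordinate where [x] and [y] differ gives a neighbour of [x] one step closer to
   [y]. *)
pose z : hypercube m := symdiff x [set i].
have e : symdiff z y = symdiff x y :\ i.
  apply/setP => j; rewrite in_setD1 !in_symdiff inE.
  have [->|_] := eqVneq j i; last by rewrite addbF.
  by move: ixy; rewrite in_symdiff; case: (_ \in x) (_ \in y) => [] [].
have zy : #|symdiff z y| = n.
  by apply/eqP; rewrite -eqSS -xy [eqbRHS](cardsD1 i) ixy e.
exists z; last exact: IHn.
rewrite /= /cube_edge (_ : symdiff x z = [set i]) ?cards1 //.
by apply/setP => j; rewrite !in_symdiff addKb.
Qed.

Lemma dist_hypercube (x y : hypercube m) : dist x y = Some #|symdiff x y|.
Proof.
by apply/distP; split; [exact: walk_hypercube|move=> k; exact: walk_hypercube_min].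
Qed.

End Hamming.

(** * Shattering and VC-dimension *)

Section Shattering.
Variable T : finType.
Implicit Types (F : {set {set T}}) (X : {set T}).

Lemma shattersP F X :
  reflect (forall b : T -> bool,
             exists2 A, A \in F & {in X, forall i, (i \in A) = b i})
          (shatters F X).
Proof.
apply: (iffP eqP) => [eF b|hF].
  have : [set i in X | b i] \in powerset X.
    by rewrite inE; apply/subsetP => i; rewrite inE => /andP[].
  rewrite -eF => /imsetP[A AF /setP eA]; exists A => // i iX.
  by have := eA i; rewrite !inE iX.
apply/setP => Y; rewrite inE; apply/imsetP/idP => [[A _ ->]|sYX].
  exact: subsetIl.
have [A AF hA] := hF (mem Y); exists A => //.
apply/setP => i; rewrite inE; case iX: (i \in X) => /=; first by rewrite hA.
by apply: contraFF iX => /(subsetP sYX).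
Qed.

Lemma shatters_vcdim F X : shatters F X -> #|X| <= vcdim F.
Proof. by move=> FX; rewrite /vcdim (bigmax_sup X). Qed.

Lemma vcdim_leP F d :
  reflect (forall X, shatters F X -> #|X| <= d) (vcdim F <= d).
Proof. exact: bigmax_leqP. Qed.

(** Injectivity of [j] comes for free: a member realising [pred1 i] separates [j i] from every other
    [j i']. *)
Lemma indexed_shatters_vcdim F (I : finType) (j : I -> T) :
  (forall b : I -> bool, exists2 A, A \in F & forall i, (j i \in A) = b i) ->
  #|I| <= vcdim F.
Proof.
move=> hF; have j_inj : injective j.
  move=> i i' eij; have [A _ hA] := hF (pred1 i).
  by apply/esym/eqP; have := hA i'; rewrite -eij hA /= eqxx.
rewrite -(card_codom j_inj) -cardsE; apply/shatters_vcdim/shattersP => b.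
have [A AF hA] := hF (b \o j); exists A => // k.
by rewrite inE => /codomP[i ->]; rewrite hA.
Qed.

End Shattering.

(** * Isometric embeddings and independence of the VC-dimension from them *)

Section IsometricEmbedding.
Variables (G : sgraph) (m : nat) (f : G -> hypercube m).

Lemma isometric_embeddingP :
  isometric_embedding f <->
  forall x y, walk x y #|symdiff (f x) (f y)| /\
              forall k, walk x y k -> #|symdiff (f x) (f y)| <= k.
Proof.
split=> fI x y; first by apply/distP; rewrite -fI dist_hypercube.
by rewrite dist_hypercube; apply/esym/distP.
Qed.

Hypothesis fI : isometric_embedding f.

Lemma isometric_walk x y : walk x y #|symdiff (f x) (f y)|.
Proof. by have [] := isometric_embeddingP.1 fI x y. Qed.

Lemma isometric_walk_min x y k :
  walk x y k -> #|symdiff (f x) (f y)| <= k.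
Proof. by have [_ ] := isometric_embeddingP.1 fI x y; apply. Qed.

Lemma isometric_edge x y : sedge x y = (#|symdiff (f x) (f y)| == 1).
Proof.
apply/idP/eqP => [xy|xy]; last first.
  have := isometric_walk x y; rewrite xy => /walkS[z xz].
  by rewrite walk0 => /eqP <-.
apply/eqP; rewrite eqn_leq isometric_walk_min /=; last first.
  by apply/walkS; exists y; rewrite ?walk0.
rewrite lt0n; apply: contraTneq xy => xy0.
have := isometric_walk x y; rewrite xy0 walk0 => /eqP->.
by rewrite sedge_irr.
Qed.

End IsometricEmbedding.

Lemma in_family_of (G : sgraph) m (f : G -> hypercube m) (V : {set G}) x :
  x \in V -> (f x : {set 'I_m}) \in family_of f V.
Proof. by move=> xV; apply/imsetP; exists x. Qed.

(** Each coordinate in a set shattered through [f] equals some coordinate of [g] up to complement,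
    and complementing coordinates preserves shattering. *)
Lemma vcdim_embedding_le (G : sgraph) (m n : nat) (f : G -> hypercube m)
    (g : G -> hypercube n) :
  connected G -> isometric_embedding f -> isometric_embedding g ->
  vcdim (family_of f [set: G]) <= vcdim (family_of g [set: G]).
Proof.
move=> Gconn fI gI.
have eq_h x y : #|symdiff (f x) (f y)| = #|symdiff (g x) (g y)|.
  by apply/eqP; rewrite eqn_leq !isometric_walk_min ?isometric_walk.
apply/vcdim_leP => X /shattersP FX.
have match_coord (i : {i | i \in X}) : exists js : 'I_n * bool,
    forall z, (js.1 \in g z) = (val i \in f z) (+) js.2.
  (* Shattering makes coordinate [i] non-constant, so by connectedness it changes along some edge
     [uv]. *)
  have [_ /imsetP[x _ ->] hx] := FX predT.
  have [_ /imsetP[y _ ->] hy] := FX pred0.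
  have [u [v [uv iu iv]]] := @connect_change _ _ (fun z => val i \in f z) x y
    (Gconn x y) (hx _ (valP i)) (negbT (hy _ (valP i))).
  have fuv : symdiff (f u) (f v) = [set val i].
    have /cards1P[k ek] : #|symdiff (f u) (f v)| == 1 by rewrite -isometric_edge.
    apply/eqP; rewrite ek eq_sym eqEcard !cards1 sub1set -ek in_symdiff iu.
    by rewrite (negPf iv).
  have /cards1P[j guv] : #|symdiff (g u) (g v)| == 1 by rewrite -isometric_edge.
  (* The Boolean records whether [i] and [j] are oriented oppositely along [uv]. *)
  exists (j, ~~ (j \in g u)) => z /=.
  have := card_symdiff_halfspace (f z) fuv; rewrite !eq_h.
  rewrite (card_symdiff_halfspace (g z) guv) iu.
  by case: (_ \in g z) (_ \in g u) (_ \in f z) => [] [] [].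
have [js hjs] := fin_all_exists match_coord.
rewrite -card_sig; apply: (@indexed_shatters_vcdim _ _ _ (fun i => (js i).1)) => b.
(* The prescribed bits are corrected by the orientations; the value off [X] is arbitrary. *)
pose c k := if insub k is Some i then b i (+) (js i).2 else false.
have [_ /imsetP[z _ ->] hz] := FX c.
exists (g z); first exact: in_family_of.
by move=> i; rewrite hjs hz ?(valP i) // /c valK addbK.
Qed.

(** * One more cube coordinate, placed at [ord0] *)

Section CubeExtension.
Variable m : nat.

Definition cube_extend (s : bool) (A : {set 'I_m}) : {set 'I_m.+1} :=
  [set i | if unlift ord0 i is Some j then j \in A else s].

Definition cube_restrict (X : {set 'I_m.+1}) : {set 'I_m} :=
  [set j | lift ord0 j \in X].

Lemma ord0_cube_extend s A : (ord0 \in cube_extend s A) = s.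
Proof. by rewrite inE unlift_none. Qed.

Lemma lift0_cube_extend s A j : (lift ord0 j \in cube_extend s A) = (j \in A).
Proof. by rewrite inE liftK. Qed.

Lemma card_cube_restrict (X : {set 'I_m.+1}) :
  #|X| = (ord0 \in X) + #|cube_restrict X|.
Proof.
rewrite -!sum1_card big_mkcond big_ord_recl /=; congr (_ + _).
by rewrite [RHS]big_mkcond; apply: eq_bigr => j _; rewrite inE.
Qed.

Lemma card_symdiff_extend s t A B :
  #|symdiff (cube_extend s A) (cube_extend t B)| = (s (+) t) + #|symdiff A B|.
Proof.
rewrite card_cube_restrict in_symdiff !ord0_cube_extend; congr (_ + #|pred_of_set _|).
by apply/setP => j; rewrite inE !in_symdiff !lift0_cube_extend.
Qed.

End CubeExtension.

(** * The expansion: its embedding and its VC-dimension *)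

Section Expansion.
Variables (G : sgraph) (m : nat) (phi : G -> hypercube m) (V1 V2 : {set G}).
Hypotheses (phiI : isometric_embedding phi) (cov : isometric_cover V1 V2).

Lemma cover_crossing x y n :
  x \in V1 -> y \in V2 -> walk x y n ->
  exists u k l, [/\ u \in V1 :&: V2, k + l = n, walk x u k & walk u y l].
Proof.
move=> xV1 yV2; elim: n x xV1 => [|n IHn] x xV1 wxy.
  exists x, 0, 0; rewrite inE xV1 walk0 eqxx; split=> //.
  by move: wxy; rewrite walk0 => /eqP->.
have [xV2|xV2] := boolP (x \in V2).
  by exists x, 0, n.+1; rewrite inE xV1 xV2 walk0 eqxx.
move: wxy => /walkS[z xz wzy].
(* As [x] is outside [V2], the edge [xz] can only come from the [V1] side. *)
have zV1 : z \in V1.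
  by move: (xz); rewrite (cover_edges cov) (negPf xV2) orbF => /and3P[].
have [u [k [l [uV <- wu wy]]]] := IHn z zV1 wzy.
by exists u, k.+1, l; split=> //; apply/walkS; exists z.
Qed.

(** Cutting a geodesic at its crossing point bounds the sum from above; the triangle inequality
    gives the converse. *)
Lemma isometric_crossing x y :
  x \in V1 -> y \in V2 -> exists2 u, u \in V1 :&: V2 &
    #|symdiff (phi x) (phi u)| + #|symdiff (phi u) (phi y)| =
    #|symdiff (phi x) (phi y)|.
Proof.
move=> xV1 yV2.
have [u [k [l [uV kl wk wl]]]] := cover_crossing xV1 yV2 (isometric_walk phiI x y).
exists u => //; apply/eqP; rewrite eqn_leq card_symdiff_trans andbT -kl.
by rewrite leq_add ?isometric_walk_min.
Qed.

Lemma isometric_subgraph_walk (V : {set G}) (x y : induced V) :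
  isometric_subgraph V -> walk x y #|symdiff (phi (val x)) (phi (val y))|.
Proof.
by move=> VI; have := VI x y; rewrite -phiI dist_hypercube => /distP[].
Qed.

Definition expansion_embedding (u : expansion V1 V2) : hypercube m.+1 :=
  match u with
  | inl x => cube_extend false (phi (val x))
  | inr x => cube_extend true (phi (val x))
  end.

(** The walk stays in the first copy up to a crossing vertex [u], changes copy there, which costs
    the extra step, and continues in the second copy. *)
Lemma expansion_walk_across (x : induced V1) (y : induced V2) :
  @walk (expansion V1 V2) (inl x) (inr y)
        #|symdiff (phi (val x)) (phi (val y))|.+1.
Proof.
have [u /setIP[uV1 uV2] <-] := isometric_crossing (valP x) (valP y).
rewrite -addnS.
apply: (@walk_cat (expansion V1 V2) _ (inl (exist _ u uV1 : induced V1))).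
  apply: (@walk_map (induced V1) (expansion V1 V2) inl) => //.
  exact: (isometric_subgraph_walk x (Sub u uV1) (cover_isometric1 cov)).
apply/(@walkS (expansion V1 V2)).
exists (inr (exist _ u uV2 : induced V2)); first exact: eqxx.
apply: (@walk_map (induced V2) (expansion V1 V2) inr) => //.
exact: (isometric_subgraph_walk (Sub u uV2) y (cover_isometric2 cov)).
Qed.

Lemma expansion_embedding_isometric : isometric_embedding expansion_embedding.
Proof.
apply/isometric_embeddingP => u v; split; last first.
  (* Lower bound: the embedding sends edges to cube edges, so walks map to walks of the same
     length. *)
  move=> k uv; apply: walk_hypercube_min; apply: walk_map uv => {v}u v.
  rewrite /= /cube_edge; case: u v => [x|x] [y|y] /=;
    rewrite card_symdiff_extend //= /induced_edge ?(isometric_edge phiI) //;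
    by move=> /eqP->; rewrite eqSS card_symdiff0.
case: u v => [x|x] [y|y] /=; rewrite card_symdiff_extend /=.
- apply: (@walk_map (induced V1) (expansion V1 V2) inl) => //.
  exact: isometric_subgraph_walk (cover_isometric1 cov).
- exact: expansion_walk_across.
- by apply: walk_sym; rewrite symdiffC; exact: expansion_walk_across.
- apply: (@walk_map (induced V2) (expansion V1 V2) inr) => //.
  exact: isometric_subgraph_walk (cover_isometric2 cov).
Qed.

Lemma expansion_connected : connected (expansion V1 V2).
Proof.
move=> u v.
have /walkP[p [_ pp <-]] := isometric_walk expansion_embedding_isometric u v.
by apply/connectP; exists p.
Qed.

(** Both copies of a vertex of [V1 :&: V2] occur and differ only at [ord0], so [ord0] can be added
    to any set shattered there. *)
Lemma vcdim_expansion_gt :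
  vcdim (family_of phi (V1 :&: V2)) <
  vcdim (family_of expansion_embedding [set: expansion V1 V2]).
Proof.
have gt_shattered X : shatters (family_of phi (V1 :&: V2)) X ->
    #|X| < vcdim (family_of expansion_embedding [set: expansion V1 V2]).
  move=> /shattersP FX; rewrite -[#|X|]card_sig -card_option.
  pose j (i : option {i | i \in X}) : 'I_m.+1 :=
    if i is Some k then lift ord0 (val k) else ord0.
  apply: (@indexed_shatters_vcdim _ _ _ j) => b.
  pose c k := if insub k is Some i then b (Some i) else false.
  have [_ /imsetP[z /setIP[zV1 zV2] ->] hz] := FX c.
  exists (cube_extend (b None) (phi z)).
    case: (b None).
      exact: (@in_family_of (expansion V1 V2) _ expansion_embedding _
                (inr (exist _ z zV2 : induced V2)) (in_setT _)).
    exact: (@in_family_of (expansion V1 V2) _ expansion_embedding _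
              (inl (exist _ z zV1 : induced V1)) (in_setT _)).
  move=> [i|] /=; last exact: ord0_cube_extend.
  by rewrite lift0_cube_extend hz ?(valP i) // /c valK.
(* The expansion cannot have value [0]: the nonempty [V1 :&: V2] shatters [set0], which would give
   [0 < 0]. *)
case def_v: (vcdim _) gt_shattered => [|n] gt_shattered.
  have [z zV] := set0Pn _ (cover_meet cov).
  suff /gt_shattered : shatters (family_of phi (V1 :&: V2)) set0 by [].
  apply/shattersP => b; exists (phi z); first exact: in_family_of.
  by move=> i; rewrite inE.
by rewrite ltnS; apply/vcdim_leP.
Qed.

Lemma vcdim_expansion_le d :
  vcdim (family_of phi [set: G]) <= d ->
  vcdim (family_of phi (V1 :&: V2)) < d ->
  vcdim (family_of expansion_embedding [set: expansion V1 V2]) <= d.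
Proof.
move=> led ltd; apply/vcdim_leP => X /shattersP FX; rewrite card_cube_restrict.
pose c s (b : 'I_m -> bool) (i : 'I_m.+1) :=
  if unlift ord0 i is Some j then b j else s.
(* If [ord0] is not in [X], forgetting the side turns [X] into a set shattered by [G] itself. *)
case X0: (ord0 \in X) => /=; last first.
  apply: leq_trans led; apply/shatters_vcdim/shattersP => b.
  have [_ /imsetP[u _ ->] hu] := FX (c false b).
  pose x := match u with inl x => val x | inr x => val x end.
  exists (phi x); first exact: in_family_of.
  move=> j; rewrite inE => /hu; rewrite /c liftK => <-.
  by rewrite /x; case: u {hu x} => x /=; rewrite lift0_cube_extend.
rewrite add1n; apply: leq_ltn_trans ltd; apply/shatters_vcdim/shattersP => b.
(* The value prescribed at [ord0] selects the copy, so [b] is realised once on each side. *)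
have [x1 hx1] : exists x : induced V1,
    {in cube_restrict X, forall j, (j \in phi (val x)) = b j}.
  have [_ /imsetP[u _ ->] hu] := FX (c false b); have := hu _ X0.
  rewrite /c unlift_none; case: u hu => x hx /=; rewrite ord0_cube_extend // => _.
  exists x => j; rewrite inE => /hx.
  by rewrite /= lift0_cube_extend /c liftK.
have [x2 hx2] : exists x : induced V2,
    {in cube_restrict X, forall j, (j \in phi (val x)) = b j}.
  have [_ /imsetP[u _ ->] hu] := FX (c true b); have := hu _ X0.
  rewrite /c unlift_none; case: u hu => x hx /=; rewrite ord0_cube_extend // => _.
  exists x => j; rewrite inE => /hx.
  by rewrite /= lift0_cube_extend /c liftK.
have [u uV geo] := isometric_crossing (valP x1) (valP x2).
exists (phi u); first exact: in_family_of.
by move=> j jX; rewrite (card_symdiff_between geo) ?hx1 ?hx2.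
Qed.

End Expansion.

Theorem proposition15 (d m : nat) (G : sgraph) (phi : G -> hypercube m)
    (V1 V2 : {set G}) :
  connected G ->
  isometric_embedding phi ->
  vcdim (family_of phi [set: G]) <= d ->
  isometric_cover V1 V2 ->
  partial_cube_vcdim_le (expansion V1 V2) d <->
  ((vcdim (family_of phi (V1 :&: V2)))%:Z <= d%:Z - 1)%R.
Proof.
move=> _ phiI led cov.
(* Subtraction in the integers makes the bound [-1] when [d] is [0], hence false, just like the
   strict inequality in [nat]. *)
have -> : ((vcdim (family_of phi (V1 :&: V2)))%:Z <= d%:Z - 1)%R =
          (vcdim (family_of phi (V1 :&: V2)) < d).
  by rewrite Num.Theory.lerBrDr -PoszD lez_nat addn1.
have psiI := expansion_embedding_isometric phiI cov.
split=> [[n [g [gI led']]]|ltd].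
  (* The given embedding [g] is arbitrary, so it is compared with the one built from [phi]. *)
  apply: leq_trans (vcdim_expansion_gt phi cov) (leq_trans _ led').
  exact: vcdim_embedding_le (expansion_connected phiI cov) psiI gI.
exists m.+1, (expansion_embedding (V1 := V1) (V2 := V2) phi).
by split=> //; exact: vcdim_expansion_le.
Qed.
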